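(* Let $m$ be a non-negative integer. Then $$\sum_{\substack{\sum i y_i=m\\ \sum y_i\text{ even}}}\prod_{i=1}^{m}\frac{1}{i^{y_i}\,y_i!}=\begin{cases}1 & \text{for } m=0,\\ 0 & \text{for } m=1,\\ \tfrac12 & \text{for } m\ge2,\end{cases}\qquad \sum_{\substack{\sum i y_i=m\\ \sum y_i\text{ odd}}}\prod_{i=1}^{m}\frac{1}{i^{y_i}\,y_i!}=\begin{cases}0 & \text{for } m=0,\\ 1 & \text{for } m=1,\\ \tfrac12 & \text{for } m\ge2,\end{cases}$$ where the sums run over the partitions $(y_1,\ldots,y_m)$ of $m$ for which $\sum y_i$ is even, respectively odd.
   Context: A partition of $m$ is represented by the tuple $(y_1,\ldots,y_m)$ of non-negative integers with $\sum_{i=1}^m i\,y_i=m$, and $\sum y_i$ denotes $\sum_{i=1}^m y_i$. For $m=0$ there is exactly one partition, the empty one, with $\sum y_i=0$. Empty products equal $1$ and empty sums equal $0$. *)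

(* Defs.v *)
From mathcomp Require Import all_boot all_order all_algebra.

Set Implicit Arguments.
Unset Strict Implicit.
Unset Printing Implicit Defensive.

Import GRing.Theory.
Local Open Scope ring_scope.

(* Ordinals are 0-based: the multiplicity y_i of the part i (1 <= i <= m) is
   y (i-1).  Bounding the multiplicities by m makes the type finite and loses
   no partition, by mult_le below. *)
Definition mults (m : nat) : finType := {ffun 'I_m -> 'I_m.+1}.

Definition is_partition (m : nat) (y : mults m) : bool :=
  (\sum_(i < m) i.+1 * y i == m)%N.

Definition num_parts (m : nat) (y : mults m) : nat := (\sum_(i < m) y i)%N.

Definition weight (m : nat) (y : mults m) : rat :=
  \prod_(i < m) (1 / ((i.+1)%:R ^+ y i * ((y i)`!)%:R)).

Lemma mult_le (m : nat) (y : 'I_m -> nat) :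
  (\sum_(i < m) i.+1 * y i)%N = m -> forall i, (y i <= m)%N.
Proof.
move=> ym i; rewrite -[leqRHS]ym (bigD1 i) //=.
by apply: leq_trans (leq_addr _ _); rewrite leq_pmull.
Qed.

(* Main.v *)
Require Import Defs.
From mathcomp Require Import all_boot all_order all_algebra.
From mathcomp Require Import ring zify.

(** Mark every part with a factor [t]: for fixed [N], let [Z_n(t)] be the sum of
    [t ^ (number of parts) * weight] over the partitions of [n] into parts of
    size at most [N].  The even and odd sums of the theorem are
    [(Z_m(1) + Z_m(-1)) / 2] and [(Z_m(1) - Z_m(-1)) / 2], so it is enough to
    know [Z_m] at [t = 1] and [t = -1].

    The classical generating function [sum_n Z_n(t) x^n = (1 - x)^(-t)] gives
    [Z_n(t) = t (t + 1) ... (t + n - 1) / n!], hence [Z_n(1) = 1] and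
    [Z_n(-1) = 1, -1, 0, 0, ...].  The proof below stays at the level of
    coefficients.  Removing one part of size [i] from a partition
    multiplies its weight by [i * y_i] ([weight_add_part],
    [sum_marked_part]).  Since [n] is the sum of the [i * y_i], summing over [i] yields
    [n * Z_n = t * (Z_0 + ... + Z_(n-1))] ([gen_sum_marked]); subtracting two
    consecutive instances leaves [(n + 1) * Z_(n+1) = (n + t) * Z_n]
    ([gen_sum_rec]).

    Only partitions of [n <= N] matter, and they form a family indexed by the
    single type [mults N]; this is why the number of available part sizes is
    kept equal to [N] throughout while [n] varies. *)

Set Implicit Arguments.
Unset Strict Implicit.
Unset Printing Implicit Defensive.

Import GRing.Theory.
Local Open Scope ring_scope.

Definition part_sum (N : nat) (y : mults N) : nat := (\sum_(i < N) i.+1 * y i)%N.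

(** [inord] overflows only when [y i = N], which no partition of a number
    below [N] has; parts are added only to partitions of [n - i] with
    [n <= N]. *)
Definition add_part (N : nat) (i : 'I_N) (y : mults N) : mults N :=
  [ffun j => inord (y j + (j == i))].

Definition remove_part (N : nat) (i : 'I_N) (y : mults N) : mults N :=
  [ffun j => inord (y j - (j == i))].

Definition gen_sum (N : nat) (t : rat) (n : nat) : rat :=
  \sum_(y : mults N | part_sum y == n) t ^+ num_parts y * weight y.

Lemma mult_le_part_sum (N : nat) (y : mults N) (i : 'I_N) :
  (i.+1 * y i <= part_sum y)%N.
Proof. by rewrite /part_sum (bigD1 i) //= leq_addr. Qed.

Lemma add_partE (N : nat) (i j : 'I_N) (y : mults N) :
  (y i < N)%N -> add_part i y j = (y j + (j == i))%N :> nat.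
Proof.
move=> yi; rewrite ffunE inordK //.
case: eqP => [->|_]; first by rewrite addn1.
by rewrite addn0 ltn_ord.
Qed.

Lemma remove_partE (N : nat) (i j : 'I_N) (y : mults N) :
  remove_part i y j = (y j - (j == i))%N :> nat.
Proof.
by rewrite ffunE inordK // (leq_ltn_trans (leq_subr _ _)) // ltn_ord.
Qed.

Lemma remove_partK (N : nat) (i : 'I_N) (y : mults N) :
  (0 < y i)%N -> add_part i (remove_part i y) = y.
Proof.
move=> yi; apply/ffunP=> j; apply: val_inj => /=.
rewrite add_partE !remove_partE; last first.
  by have := ltn_ord (y i); rewrite eqxx; lia.
by case: eqP => [->|_]; rewrite ?subnK ?subn0 ?addn0.
Qed.

Lemma add_partK (N : nat) (i : 'I_N) (y : mults N) :
  (y i < N)%N -> remove_part i (add_part i y) = y.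
Proof.
move=> yi; apply/ffunP=> j; apply: val_inj => /=.
by rewrite remove_partE add_partE // addnK.
Qed.

Lemma add_part_lt (N : nat) (i : 'I_N) (y : mults N) :
  remove_part i (add_part i y) = y -> (y i < N)%N.
Proof.
move=> <-; rewrite remove_partE eqxx subn1.
by case: (add_part i _ i) => [[|k] //= _]; apply: leq_ltn_trans (ltn_ord i).
Qed.

Lemma part_sum_add_part (N : nat) (i : 'I_N) (y : mults N) :
  (y i < N)%N -> part_sum (add_part i y) = (part_sum y + i.+1)%N.
Proof.
move=> yi; rewrite /part_sum (bigD1 i) //= [in RHS](bigD1 i) //=.
rewrite add_partE // eqxx mulnDr muln1 addnAC; congr (_ + _ + _)%N.
by apply: eq_bigr => j /negbTE ji; rewrite add_partE // ji addn0.
Qed.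

Lemma num_parts_add_part (N : nat) (i : 'I_N) (y : mults N) :
  (y i < N)%N -> num_parts (add_part i y) = (num_parts y).+1.
Proof.
move=> yi; rewrite /num_parts (bigD1 i) //= [in RHS](bigD1 i) //=.
rewrite add_partE // eqxx addn1 addSn; congr (_ + _).+1.
by apply: eq_bigr => j /negbTE ji; rewrite add_partE // ji addn0.
Qed.

(** Raising [y_i] by one multiplies the denominator [i^y_i y_i!] by [i] and by
    the new multiplicity. *)
Lemma weight_add_part (N : nat) (i : 'I_N) (y : mults N) :
  (y i < N)%N ->
  (i.+1 * add_part i y i)%:R * weight (add_part i y) = weight y.
Proof.
move=> yi; rewrite /weight (bigD1 i) //= [in RHS](bigD1 i) //= mulrA.
congr (_ * _); last first.
  by apply: eq_bigr => j /negbTE ji; rewrite add_partE // ji addn0.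
rewrite add_partE // eqxx addn1 factS exprS !natrM.
field.
by rewrite !nat1r expf_neq0 !Num.Theory.pnatr_eq0 // -lt0n fact_gt0.
Qed.

(** Partitions of [n] counted with the factor [i * y_i]: those without a part
    [i] drop out, and removing one part [i] from the others is a bijection onto
    the partitions of [n - i]. *)
Lemma sum_marked_part (N : nat) (i : 'I_N) (t : rat) (n : nat) :
  (n <= N)%N ->
  \sum_(y : mults N | part_sum y == n)
     (i.+1 * y i)%:R * (t ^+ num_parts y * weight y)
  = t * \sum_(y : mults N | (part_sum y + i.+1 == n)%N)
           t ^+ num_parts y * weight y.
Proof.
move=> nN; rewrite (bigID (fun y : mults N => 0 < y i)%N) /= addrC big1.
  rewrite add0r (reindex_onto (add_part i) (remove_part i)); last first.
    by move=> y /andP[_ yi]; apply: remove_partK.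
  rewrite mulr_sumr; apply: eq_big => [y | y].
    have [yi|yi] := ltnP (y i) N.
      by rewrite part_sum_add_part // add_partK // add_partE // !eqxx addn1 !andbT.
    (* Here [y i = N]: the left condition fails because [add_part] overflows,
       the right one because [y] is already too large. *)
    apply/idP/idP => [/andP[_ /eqP/add_part_lt]|]; first by rewrite ltnNge yi.
    move/eqP=> yn; exfalso.
    by have := mult_le_part_sum y i; rewrite mulSn; lia.
  case/andP=> _ /eqP/add_part_lt yi.
  by rewrite num_parts_add_part // exprS mulrCA weight_add_part // mulrA.
by move=> y /andP[_]; rewrite lt0n negbK => /eqP->; rewrite muln0 mul0r.
Qed.

(** [n * Z_n = t * (Z_(n-1) + Z_(n-2) + ...)], with [Z_(n-i)] written as a sum
    over [part_sum y + i = n] so that it vanishes for [i > n]. *)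
Lemma gen_sum_marked (N : nat) (t : rat) (n : nat) :
  (n <= N)%N ->
  n%:R * gen_sum N t n
  = t * \sum_(i < N) \sum_(y : mults N | (part_sum y + i.+1 == n)%N)
           t ^+ num_parts y * weight y.
Proof.
move=> nN; rewrite !mulr_sumr.
rewrite -(eq_bigr _ (fun i _ => sum_marked_part i t nN)) exchange_big /=.
apply: eq_bigr => y /eqP <-.
by rewrite -mulr_suml -natr_sum.
Qed.

(** The two instances of [gen_sum_marked] have the same inner sums up to a
    shift of [i]; only the term [i = 1], which is [Z_n], is new. *)
Lemma gen_sum_rec (N : nat) (t : rat) (n : nat) :
  (n < N)%N -> n.+1%:R * gen_sum N t n.+1 = (n%:R + t) * gen_sum N t n.
Proof.
case: N => // N nN.
rewrite mulrDl !gen_sum_marked ?(ltnW nN) // -mulrDr; congr (_ * _).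
rewrite big_ord_recl [in RHS]big_ord_recr /= [X in _ + X + _]big1 ?addr0; last first.
  by move=> y /eqP; lia.
rewrite addrC; congr (_ + _).
  apply: eq_bigr => i _; apply: eq_bigl => y.
  by rewrite /bump /= add1n addnS eqSS.
by apply: eq_bigl => y; rewrite addn1 eqSS.
Qed.

Lemma gen_sum0 (N : nat) (t : rat) : gen_sum N t 0 = 1.
Proof.
rewrite /gen_sum (big_pred1 [ffun=> ord0]) => [|y].
  by rewrite /num_parts /weight !big1 ?expr0 ?mulr1 // => i _; rewrite ffunE.
rewrite /part_sum sum_nat_eq0; apply/forallP/eqP => /= [y0|-> i]; last first.
  by rewrite ffunE muln0.
apply/ffunP=> i; rewrite ffunE; apply/val_inj/eqP.
by have /= := y0 i; rewrite muln_eq0.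
Qed.

Lemma gen_sum1 (N n : nat) : (n <= N)%N -> gen_sum N 1 n = 1.
Proof.
elim: n => [_|n IHn nN]; first exact: gen_sum0.
have n1 : n.+1%:R != 0 :> rat by rewrite Num.Theory.pnatr_eq0.
by apply: (mulfI n1); rewrite gen_sum_rec // IHn ?(ltnW nN) // natr1.
Qed.

Lemma gen_sumN1 (N n : nat) : (n <= N)%N ->
  gen_sum N (-1) n = match n with 0%N => 1 | 1%N => -1 | _ => 0 end.
Proof.
elim: n => [_|n IHn nN]; first exact: gen_sum0.
have n1 : n.+1%:R != 0 :> rat by rewrite Num.Theory.pnatr_eq0.
apply: (mulfI n1); rewrite gen_sum_rec // IHn ?(ltnW nN) //.
by case: n {IHn nN n1} => [|[|n]]; rewrite ?subrr ?mul0r ?mulr0 // add0r mulrC.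
Qed.

Lemma gen_sum_parity (m : nat) (t : rat) : t ^+ 2 = 1 ->
  gen_sum m t m
  = \sum_(y : mults m | is_partition y && ~~ odd (num_parts y)) weight y
    + t * \sum_(y : mults m | is_partition y && odd (num_parts y)) weight y.
Proof.
move=> t2; have tE k : t ^+ k = if odd k then t else 1.
  rewrite -{1}(odd_double_half k) exprD -mul2n exprM t2 expr1n mulr1.
  by case: odd.
rewrite /gen_sum (bigID (fun y : mults m => odd (num_parts y))) /= addrC mulr_sumr.
congr (_ + _); apply: eq_bigr => y /andP[_ oy]; rewrite tE.
  by rewrite (negbTE oy) mul1r.
by rewrite oy.
Qed.

Theorem theorem6p2 (m : nat) :
  \sum_(y : mults m | is_partition y && ~~ odd (num_parts y)) weight y
    = match m with 0%N => 1 | 1%N => 0 | _ => 1 / 2 end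
  /\
  \sum_(y : mults m | is_partition y && odd (num_parts y)) weight y
    = match m with 0%N => 0 | 1%N => 1 | _ => 1 / 2 end.
Proof.
have := gen_sum_parity m (expr1n _ 2); have := @gen_sum_parity m (-1) (sqrr_sign _ 1).
rewrite gen_sum1 // gen_sumN1 //.
set e := \sum_(y | _ && ~~ _) _; set o := \sum_(y | _) _.
rewrite mulN1r mul1r => dE sE.
have eE : e = (e + o + (e - o)) / 2 by field.
have oE : o = (e + o - (e - o)) / 2 by field.
rewrite -sE -dE in eE oE.
by rewrite eE oE; case: m {e o dE sE eE oE} => [|[|m]] /=; split; field.
Qed.
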